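(* A graph $G$ is a quasi-banana graph if and only if it is gonality-tight and there exists a vertex $v\in V(G)$ such that the divisor \[ D=v+\sum_{w\in V(G)}w \] realises the second gonality of $G$.
   Context: All graphs are finite connected loopless multigraphs. A divisor on a graph $G$ is an element $D=\sum_{w\in V(G)}D(w)\cdot w$ of the free abelian group on $V(G)$; its degree is $\deg(D)=\sum_w D(w)$, and it is effective if $D(w)\ge 0$ for all $w$. Firing a vertex $v$ replaces $D$ by the divisor in which $v$ loses one chip along each incident edge and the vertex at the other end of each such edge gains one chip. Two divisors are linearly equivalent ($\sim$) if one is obtained from the other by a finite sequence of firings and inverse firings. The rank of $D$ is $-1$ if $D$ is not equivalent to an effective divisor, and otherwise is the largest integer $r\ge 0$ such that $D-E$ is equivalent to an effective divisor for every effective divisor $E$ of degree $r$. The $r$-th gonality $\mathrm{gon}_r(G)$ is the smallest degree of a divisor of rank $r$ on $G$. A divisor realises the $r$-th gonality if it has rank $r$ and degree $\mathrm{gon}_r(G)$. $G$ is gonality-tight if $\mathrm{gon}_2(G)=\mathrm{gon}_1(G)+1$. Quasi-banana graphs: let $m\ge 0$ be an integer and $N=(q_1,\dots,q_m)$ an $m$-tuple of positive integers. The graph $QB_m(N)$ has vertex set $\bigcup_{i=0}^m C_i$ (a disjoint union), where $C_0=\{u_{0,1}\}$ and $C_i=\{u_{i,j}\mid 1\le j\le q_i\}$ for $1\le i\le m$. Its edges are: (1) for each $1\le i\le m$ and distinct $1\le j,k\le q_i$, exactly one edge between $u_{i,j}$ and $u_{i,k}$; (2) for each $0\le i<m$ and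 $1\le j\le q_{i+1}$, exactly $\sum_{k=1}^{i}q_k+2$ edges between $u_{i,1}$ and $u_{i+1,j}$; (3) no other edges. A quasi-banana graph is a graph isomorphic to some $QB_m(N)$. *)

(* Defs.v *)
(* Libraries: Mathematical Components, with the relational closures of Stdlib. *)
From Stdlib Require Export Relation_Operators.
From mathcomp Require Export all_boot all_order all_algebra.
Set Implicit Arguments.
Unset Strict Implicit.
Unset Printing Implicit Defensive.
Import Order.TTheory GRing.Theory Num.Theory.

(* A finite loopless multigraph is encoded by its edge multiplicities:
   [mult v w] is the number of edges between [v] and [w]. *)
Record multigraph := Multigraph {
  vertex :> finType;
  mult : vertex -> vertex -> nat;
  mult_sym : forall v w, mult v w = mult w v;
  mult_loopless : forall v, mult v v = 0%N
}.

(* The empty graph is not considered to be connected. *)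
Definition connected (G : multigraph) : Prop :=
  (0 < #|G|)%N /\
  forall v w : G, connect (fun x y : G => (0 < mult x y)%N) v w.

Definition isomorphic (G H : multigraph) : Prop :=
  exists2 f : G -> H, bijective f & forall v w, mult (f v) (f w) = mult v w.

(* An abbreviation, so that divisors inherit the pointwise additive group
   structure of finite functions. *)
Notation divisor G := {ffun vertex G -> int}.

Section Divisors.
Local Open Scope ring_scope.
Variable G : multigraph.

Implicit Types D E : divisor G.

Definition point (v : G) : divisor G := [ffun w => (w == v)%:Z].

Definition deg D : int := \sum_(w : G) D w.

Definition effective D : Prop := forall w, 0 <= D w.

Definition fire (v : G) D : divisor G :=
  [ffun w => if w == v then D v - (\sum_(u : G) mult v u)%N%:Z
             else D w + (mult v w)%:Z].

Definition lin_equiv : divisor G -> divisor G -> Prop :=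
  clos_refl_sym_trans (divisor G) (fun D D' => exists v, D' = fire v D).

Definition equiv_effective D : Prop :=
  exists2 D', lin_equiv D D' & effective D'.

(* The condition on r in the definition of rank. *)
Definition survives D (r : int) : Prop :=
  forall E, effective E -> deg E = r -> equiv_effective (D - E).

(* [has_rank D r] : the rank of [D] is [r]. *)
Definition has_rank D (r : int) : Prop :=
  (~ equiv_effective D /\ r = -1) \/
  [/\ equiv_effective D, 0 <= r, survives D r
    & forall s : int, 0 <= s -> survives D s -> s <= r].

(* [is_gonality r k] : the [r]-th gonality of [G] is [k]. *)
Definition is_gonality (r k : int) : Prop :=
  (exists2 D, has_rank D r & deg D = k) /\
  (forall D, has_rank D r -> k <= deg D).

Definition realises_gonality (r : int) D : Prop :=
  has_rank D r /\ is_gonality r (deg D).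

Definition gonality_tight : Prop :=
  exists k : int, is_gonality 1 k /\ is_gonality 2 (k + 1).

End Divisors.

Section QuasiBanana.
Variables (m : nat) (N : m.-tuple nat).

(* [qb_size i] is the cardinality of the class C_i: 1 for i = 0 and the i-th
   entry q_i of N for 1 <= i <= m. *)
Definition qb_size (i : nat) : nat := nth 0 (1 :: N) i.

(* The vertex u_{i,j} is [existT _ i (j - 1)]: second indices start at 0, so
   that u_{i,1} is the vertex of C_i with second index 0. *)
Definition qb_vertex : finType := {i : 'I_m.+1 & 'I_(qb_size i)}.

(* Number of edges of type (u_{i,1}, u_{i+1,j}) with [x] as the former end and
   [y] as the latter. *)
Definition qb_step (x y : qb_vertex) : nat :=
  if (tag y == (tag x).+1 :> nat) && (tagged x == 0 :> nat)
  then (\sum_(1 <= k < (tag x).+1) qb_size k) + 2 else 0.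

(* At most one of the three summands is nonzero. *)
Definition qb_mult (x y : qb_vertex) : nat :=
  ((tag x == tag y) && (x != y)) + qb_step x y + qb_step y x.

Lemma qb_mult_sym x y : qb_mult x y = qb_mult y x.
Proof. by rewrite /qb_mult addnAC [tag x == _]eq_sym [x == _]eq_sym. Qed.

Lemma qb_mult_loopless x : qb_mult x x = 0.
Proof.
by rewrite /qb_mult /qb_step !eqxx ltn_eqF.
Qed.

Definition QB : multigraph := Multigraph qb_mult_sym qb_mult_loopless.

End QuasiBanana.

Definition quasi_banana (G : multigraph) : Prop :=
  exists (m : nat) (N : m.-tuple nat),
    (forall i, 0 < tnth N i) /\ isomorphic G (QB N).

(* Main.v *)
From HB Require Import structures.
Require Import Defs.
From mathcomp Require Import all_boot all_order all_algebra.
From mathcomp Require Import zify ring.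
From Stdlib Require Import Classical.
Set Implicit Arguments.
Unset Strict Implicit.
Unset Printing Implicit Defensive.
Import Order.TTheory GRing.Theory Num.Theory.
Local Open Scope ring_scope.

(** Let n be the number of vertices. The divisor v + (sum of all vertices) has
degree n + 1, and removing a chip lowers the rank by at most one. So the right
hand side amounts to two facts (tight_realisesP): a divisor of positive rank has
degree at least n, and from v + (sum of all vertices) one can bring two chips to
any vertex. When the first fact is an assumption, it is contradicted by
a divisor of degree n - 1 from which each vertex can receive a chip.

Linear equivalence is handled through the Laplacian: D' is equivalent to D when
D' = D - lap f for an integer potential f (lin_equivP). Quasi-banana graphs are
handled through layerings: a level for each vertex and one portal in each level,
which is the only vertex joined to the next level (quasi_bananaP). Let n_i be the
number of vertices of level at most i.

A layered graph has both properties. Starting from v in level 0, all the chips on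
levels up to i can be gathered on any vertex w of level i, which then holds
n_i + 1 of them (layer_div): the portal of level i has exactly as many edges to
each vertex of level i + 1 as it holds chips. For the degree bound, let E and
E - lap f be effective with deg E < n. The edges that leave a level set of f are
at most as many as the chips in that set. A level set that separates a vertex of
the last level from the portal below has at least n such edges, so f takes the
same value at both. Hence chips of the last level never move; as each of its
vertices can receive a chip, each already carries one. Removing that level and
repeating the argument, every vertex carries a chip: a contradiction
(effective_deg_ge).

Conversely, the levels are reconstructed one at a time (core_step). Suppose that
L is the set of vertices already placed, that P is its last level, and that
v + (sum of all vertices) is equivalent to |L| + 1 chips on any p in P together
with one chip on each vertex outside L. To bring two chips to a vertex w outside L,
some set A containing L but not w must be fired. If p lost at most |L| chips, or if
two vertices outside A received some, then two chips could be saved, giving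
a divisor of degree n - 1 and positive rank. So A has exactly one
outer neighbour y, and y is joined to p by |L| + 1 edges and to any other vertex
of A by at most one (attached_exists). Two such vertices y and y' are adjacent,
since otherwise the two firings could be done independently, which again saves two
chips; it follows that they have the same p (attached_distinct). So the vertices y
form a clique, attached to a single portal: the next level. *)

(** * Linear equivalence through the Laplacian *)

Lemma PoszSum (I : finType) (P : pred I) (F : I -> nat) :
  (\sum_(i | P i) F i)%N%:Z = \sum_(i | P i) (F i)%:Z.
Proof. by rewrite -natz natr_sum; apply: eq_bigr => i _; rewrite natz. Qed.

Section Laplacian.
Variable G : multigraph.
Implicit Types (D E f g : divisor G) (A B T : {set G}) (x y z v w p : G).

Definition lap f : divisor G :=
  [ffun w => \sum_(u : G) (mult w u)%:Z * (f w - f u)].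

Fact lap_is_zmod_morphism : zmod_morphism lap.
Proof.
move=> f g; apply/ffunP => w; rewrite !ffunE -sumrB; apply: eq_bigr => u _.
by rewrite !ffunE; ring.
Qed.

HB.instance Definition _ :=
  GRing.isZmodMorphism.Build (divisor G) (divisor G) lap lap_is_zmod_morphism.

Definition ind A : divisor G := [ffun x => (x \in A)%:Z].

Definition out A x : nat := (\sum_(u | u \notin A) mult x u)%N.

(** [ind A] is the potential of firing every vertex of [A] once: each loses one chip
for each of its edges that leave [A]. *)
Lemma lap_ind A x :
  lap (ind A) x = if x \in A then (out A x)%:Z
                  else - (\sum_(u in A) mult x u)%N%:Z.
Proof.
rewrite ffunE /out; case: ifP => xA.
  rewrite PoszSum [RHS]big_mkcond /=; apply: eq_bigr => u _.
  by rewrite !ffunE xA; case: (u \in A) => /=; rewrite ?subrr ?mulr0 ?subr0 ?mulr1.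
rewrite PoszSum -sumrN [RHS]big_mkcond /=; apply: eq_bigr => u _.
by rewrite !ffunE xA; case: (u \in A); rewrite ?subrr ?mulr0 ?sub0r ?mulrN1.
Qed.

Lemma ind1 x : ind [set x] = point x.
Proof. by apply/ffunP => y; rewrite !ffunE inE. Qed.

Lemma ind_setT : ind setT = \sum_(w : G) point w.
Proof.
apply/ffunP => y; rewrite sum_ffunE !ffunE inE (bigD1 y) //= ffunE eqxx big1.
  by rewrite addr0.
by move=> w; rewrite ffunE eq_sym => /negbTE->.
Qed.

Lemma fire_lap v D : fire v D = D - lap (point v).
Proof.
apply/ffunP => w.
have -> : (D - lap (point v)) w = D w - lap (ind [set v]) w.
  by rewrite ind1 !ffunE.
rewrite lap_ind inE ffunE.
case: eqP => [->|_]; last by rewrite big_set1 mult_sym opprK.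
congr (_ - _%:Z); rewrite /out (bigD1 v) //= mult_loopless.
by apply: eq_bigl => u; rewrite inE.
Qed.

(** Firing v subtracts the Laplacian of [point v], and these generate all potentials. *)
Lemma lin_equivP D D' : lin_equiv D D' <-> exists f, D' = D - lap f.
Proof.
split.
  elim=> {D D'} [D D' [v ->]|D|D D' _ [f ->]|D D1 D2 _ [f ->] _ [g ->]].
  - by exists (point v); rewrite fire_lap.
  - by exists 0; rewrite raddf0 subr0.
  - by exists (- f); rewrite raddfN opprK subrK.
  - by exists (f + g); rewrite raddfD opprD addrA.
case=> f ->.
pose K f := forall D, lin_equiv D (D - lap f).
have KB g h : K g -> K h -> K (g - h).
  move=> Kg Kh E; apply: rst_trans (Kg E) _; apply: rst_sym.
  suff -> : E - lap g = E - lap (g - h) - lap h by apply: Kh.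
  by rewrite -addrA -opprD -raddfD subrK.
have K0 : K 0 by move=> E; rewrite raddf0 subr0; apply: rst_refl.
have KD g h : K g -> K h -> K (g + h).
  by move=> Kg Kh; rewrite -[h]opprK; apply: (KB) => //; rewrite -sub0r; apply: KB.
have Kp v : K (point v) by move=> E; apply: rst_step; exists v; rewrite fire_lap.
have KZ v (c : int) : K (point v *~ c).
  have Kn n : K (point v *+ n) by elim: n => [|n IH]; rewrite ?mulr0n ?mulrS; auto.
  case: c => n; first exact: Kn.
  by rewrite NegzE mulrNz -sub0r; apply: KB => //; apply: Kn.
suff -> : f = \sum_v point v *~ f v.
  apply: (big_ind K) => // v _; exact: KZ.
apply/ffunP => y; rewrite sum_ffunE (bigD1 y) //= big1 => [|w].
  by rewrite addr0 ffunMzE ffunE eqxx; lia.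
by rewrite ffunMzE ffunE eq_sym => /negbTE->; rewrite mul0rz.
Qed.
End Laplacian.

(** * Degree, rank and gonality *)

Section Rank.
Variable G : multigraph.
Implicit Types (D E F f g : divisor G) (A B T : {set G}) (x y z v w p : G).

(** Edges inside [A] are counted twice with opposite signs, so only those leaving [A]
contribute to the number of chips that [A] loses. *)
Lemma sum_lap f A :
  \sum_(x in A) lap f x =
  \sum_(x in A) \sum_(y | y \notin A) (mult x y)%:Z * (f x - f y).
Proof.
pose S := \sum_(x in A) \sum_(y in A) (mult x y)%:Z * (f x - f y).
have S0 : S = 0.
  suff : S = - S by lia.
  rewrite {1}/S exchange_big -sumrN /=; apply: eq_bigr => x _.
  by rewrite -sumrN; apply: eq_bigr => y _; rewrite mult_sym -mulrN opprB.
suff -> : \sum_(x in A) lap f x =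
  S + \sum_(x in A) \sum_(y | y \notin A) (mult x y)%:Z * (f x - f y).
  by rewrite S0 add0r.
by rewrite -big_split; apply: eq_bigr => x _; rewrite ffunE (bigID (mem A)).
Qed.

Lemma degD D E : deg (D + E) = deg D + deg E.
Proof. by rewrite -big_split; apply: eq_bigr => x _; rewrite ffunE. Qed.

Lemma degN D : deg (- D) = - deg D.
Proof. by rewrite -sumrN; apply: eq_bigr => x _; rewrite ffunE. Qed.

Lemma deg_lap f : deg (lap f) = 0.
Proof.
transitivity (\sum_(x in [set: G]) lap f x).
  by apply: eq_bigl => x; rewrite inE.
by rewrite sum_lap big1 // => x _; apply: big_pred0 => y; rewrite inE.
Qed.

Lemma deg_ind A : deg (ind A) = #|A|%:Z.
Proof.
rewrite /deg -sum1_card PoszSum [RHS]big_mkcond; apply: eq_bigr => x _.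
by rewrite ffunE; case: (x \in A).
Qed.

Lemma deg_point x : deg (point x) = 1.
Proof. by rewrite -ind1 deg_ind cards1. Qed.

Lemma deg_ge0 D : effective D -> 0 <= deg D.
Proof. by move=> eD; apply: sumr_ge0. Qed.

Lemma effectiveD D E : effective D -> effective E -> effective (D + E).
Proof. by move=> eD eE x; rewrite ffunE addr_ge0. Qed.

Lemma effective_ind A : effective (ind A).
Proof. by move=> x; rewrite ffunE. Qed.

Lemma effective_point x : effective (point x).
Proof. by rewrite -ind1; apply: effective_ind. Qed.

Lemma deg_pointMn x n : deg (point x *+ n) = n%:Z.
Proof.
elim: n => [|n IH]; last by rewrite mulrS degD IH deg_point intS.
by rewrite /deg big1 // => y; rewrite ffunE.
Qed.

Lemma effective_pointMn x n : effective (point x *+ n).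
Proof. by move=> y; rewrite ffunMnE mulrn_wge0 // effective_point. Qed.

Lemma pointMnE x n y : (point x *+ n) y = if y == x then n%:Z else 0.
Proof. by rewrite ffunMnE ffunE; case: eqP => _; rewrite ?mul0rn // natz. Qed.

Lemma effective_pos D : effective D -> 0 < deg D ->
  exists2 x, 0 < D x & effective (D - point x).
Proof.
move=> eD dD; case: (pickP (fun x => 0 < D x)) => [x Dx|D0].
  exists x => // y; rewrite !ffunE; case: eqP => [->|_] /=; first lia.
  by rewrite subr0.
move: dD; rewrite /deg big1 ?ltxx // => x _.
by have := D0 x; have := eD x; lia.
Qed.

Lemma equiv_effectiveP D :
  equiv_effective D <-> exists f, effective (D - lap f).
Proof.
split; first by case=> _ /lin_equivP[f ->]; exists f.
by case=> f ef; exists (D - lap f) => //; apply/lin_equivP; exists f.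
Qed.

(** The rank condition for a single chip on [x], in a form that survives adding
effective divisors and moving to equivalent ones. *)
Definition reaches D x : Prop :=
  exists2 f, effective (D - lap f) & 1 <= (D - lap f) x.

Lemma reachesP D x : reaches D x <-> equiv_effective (D - point x).
Proof.
rewrite equiv_effectiveP; split=> [[f ef fx]|[f ef]].
  exists f => y; have := ef y; move: fx; rewrite !ffunE.
  by case: eqP => [->|_] /=; lia.
exists f => [y|]; [have := ef y | have := ef x]; rewrite !ffunE ?eqxx /=; lia.
Qed.

Lemma effective_reaches D x : effective D -> 0 < D x -> reaches D x.
Proof. by move=> eD Dx; exists 0; rewrite raddf0 subr0. Qed.

Lemma reaches_lap D f x : reaches (D - lap f) x -> reaches D x.
Proof.
by case=> g eg gx; exists (f + g); rewrite raddfD opprD addrA.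
Qed.

Lemma reachesD D E x : effective E -> reaches D x -> reaches (D + E) x.
Proof.
move=> eE [f ef fx]; exists f; rewrite addrAC; first exact: effectiveD.
by rewrite ffunE; apply: le_trans fx _; rewrite lerDl.
Qed.

Lemma survives0 D : survives D 0 <-> equiv_effective D.
Proof.
split=> [/(_ 0)|eD E eE dE].
  by rewrite subr0; apply=> [x|]; rewrite ?ffunE // /deg big1 // => x; rewrite ffunE.
suff -> : E = 0 by rewrite subr0.
apply/ffunP => x; rewrite ffunE; apply/eqP; rewrite eq_le eE andbT.
rewrite -dE /deg (bigD1 x) //= lerDl; exact: sumr_ge0.
Qed.

Lemma survivesS D (r : int) : 0 <= r ->
  survives D (r + 1) <-> forall x, survives (D - point x) r.
Proof.
move=> r0; split=> [sD x E eE dE|sD E eE dE].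
  rewrite -addrA -opprD; apply: sD; first exact: effectiveD (effective_point _) _.
  by rewrite degD deg_point dE addrC.
have [|x _ eEx] := effective_pos eE; first lia.
have -> : D - E = D - point x - (E - point x) by rewrite opprB addrA subrK.
by apply: sD => //; rewrite degD degN deg_point dE addrK.
Qed.

Lemma survives1 D : survives D 1 <-> forall x, reaches D x.
Proof.
rewrite -[1]add0r survivesS //.
by split=> sD x; [apply/reachesP/survives0 | apply/survives0/reachesP].
Qed.

Hypothesis G_gt0 : (0 < #|G|)%N.

Lemma survives_pred D (r : int) : 0 <= r -> survives D (r + 1) -> survives D r.
Proof.
move=> r0 /survivesS-/(_ r0) sD E eE dE; have /card_gt0P[x _] := G_gt0.
have /equiv_effectiveP[f ef] := sD x E eE dE; apply/equiv_effectiveP; exists f => y.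
by have := ef y; rewrite !ffunE; lia.
Qed.

Lemma survives_le D (r s : int) : 0 <= r -> r <= s -> survives D s -> survives D r.
Proof.
move=> r0 rs; have [n ->] : exists n : nat, s = r + n%:Z by exists `|s - r|%N; lia.
elim: n => [|n IH]; first by rewrite addr0.
by rewrite intS [1 + _]addrC addrA => /survives_pred sD; apply: IH; apply: sD; lia.
Qed.

Lemma has_rankP D (r : int) : 0 <= r ->
  has_rank D r <-> survives D r /\ ~ survives D (r + 1).
Proof.
move=> r0; split=> [[[_ rN1]|[wD _ sD maxD]]|[sD nsD]].
- by move: r0; rewrite rN1.
- by split=> // /maxD; lia.
right; split=> //; first by apply/survives0; apply: survives_le sD.
move=> s s0 sDs; rewrite leNgt; apply/negP => rs; apply: nsD.
by apply: survives_le sDs; lia.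
Qed.

Definition pos_rank_deg_ge (n : int) : Prop :=
  forall D : divisor G, (forall x, reaches D x) -> n <= deg D.

Lemma survives_deg D (r : int) : 0 <= r -> survives D r -> r <= deg D.
Proof.
have /card_gt0P[x _] := G_gt0; move=> r0.
have dp : deg (point x *+ `|r|) = r by rewrite deg_pointMn; lia.
move/(_ (point x *+ `|r|) (effective_pointMn x _) dp).
case=> D' /lin_equivP[f ->] /deg_ge0.
by rewrite !degD !degN deg_lap dp; lia.
Qed.

(** Gonalities are defined by divisors of exact rank; dropping chips one at a time
from a divisor of positive rank ends at one of rank exactly 1. *)
Lemma pos_rank_rank1 D : (forall x, reaches D x) ->
  exists2 D' : divisor G, has_rank D' 1 & deg D' <= deg D.
Proof.
move=> /survives1 sD; have d0 := survives_deg ler01 sD.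
have [n dn] : exists n : nat, deg D = n%:Z by case: (deg D) d0 => // n; exists n.
elim: n D dn sD {d0} => [|n IH] D dn sD.
  by have := survives_deg ler01 sD; lia.
case: (classic (survives D (1 + 1))) => [/survivesS sD2|nsD]; last first.
  by exists D => //; apply/has_rankP.
have /card_gt0P[x _] := G_gt0.
have dx : deg (D - point x) = n%:Z by rewrite degD degN deg_point; lia.
have [D' rD' dD'] := IH _ dx (sD2 ler01 x).
by exists D' => //; lia.
Qed.

Lemma gonality1_bound (k : int) : is_gonality G 1 k -> pos_rank_deg_ge k.
Proof.
by move=> [_ minD] D /pos_rank_rank1[D' /minD]; lia.
Qed.

(** Removing chips from two distinct vertices leaves an effective divisor, so only
double chips are an obstruction. *)
Lemma survives2_vertices v :
  survives (point v + \sum_(w : G) point w) 2 <->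
  forall w, exists2 f, effective (point v + ind setT - lap f) &
    2 <= (point v + ind setT - lap f) w.
Proof.
rewrite -ind_setT -[2]/(1 + 1) survivesS //; split=> sD w.
  have /survives1 /(_ w) [f ef fw] := sD w; exists f => [y|].
    have := ef y; rewrite !ffunE; lia.
  by move: fw; rewrite !ffunE eqxx /=; lia.
apply/survives1 => x; have [->|xw] := eqVneq x w; last first.
  apply: effective_reaches => [y|]; rewrite !ffunE !inE ?(negbTE xw) /=; lia.
have [f ef fw] := sD w; exists f; last by move: fw; rewrite !ffunE eqxx /=; lia.
move=> y; have [->|yw] := eqVneq y w; first by move: fw; rewrite !ffunE eqxx /=; lia.
by have := ef y; rewrite !ffunE (negbTE yw) /=; lia.
Qed.

(** The degree of [point v + \sum_(w : G) point w] is [#|G| + 1]. The bound on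
divisors of positive rank gives [#|G| + r - 1] as a lower bound for rank [r], so this
divisor cannot have rank 3, and the sum of all vertices has rank exactly 1. *)
Lemma tight_realisesP :
  (gonality_tight G /\
   exists v, realises_gonality 2 (point v + \sum_(w : G) point w)) <->
  pos_rank_deg_ge #|G|%:Z /\
  exists v, survives (point v + \sum_(w : G) point w) 2.
Proof.
have dv v : deg (point v + \sum_(w : G) point w) = #|G|%:Z + 1.
  by rewrite degD deg_point -ind_setT deg_ind cardsT addrC.
split=> [[[k [g1 g2]] [v [rD gD]]]|[bound [v sD]]].
  have kn : k + 1 = #|G|%:Z + 1.
    have [[D1 r1 d1] m1] := g2; have [[D2 r2 d2] m2] := gD; rewrite dv in d2 m2.
    by have := m1 _ r2; have := m2 _ r1; lia.
  split; first by (have -> : #|G|%:Z = k by lia); apply: gonality1_bound.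
  by exists v; have /has_rankP[] := rD.
have noD D (r : int) : 0 <= r -> survives D (1 + r) -> #|G|%:Z + r <= deg D.
  move=> r0; have [n ->] : exists n : nat, r = n%:Z by exists `|r|%N; lia.
  elim: n D => [|n IH] D; first by rewrite !addr0 => /survives1/bound.
  have -> : 1 + n.+1%:Z = 1 + n%:Z + 1 by lia.
  have /card_gt0P[x _] := G_gt0.
  move/survivesS => sDx; have : 0 <= 1 + n%:Z by lia.
  by move=> /sDx/(_ x)/IH; rewrite degD degN deg_point; lia.
have r2 : has_rank (point v + \sum_(w : G) point w) 2.
  by apply/has_rankP => //; split=> // /(@noD _ 2); rewrite dv; lia.
have g2 : is_gonality G 2 (#|G|%:Z + 1).
  split=> [|D /has_rankP[]// sD2 _]; last exact: (@noD _ 1).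
  by exists (point v + \sum_(w : G) point w).
split; last by exists v; split=> //; rewrite dv.
exists #|G|%:Z; split=> //; split=> [|D /has_rankP[]// sD1 _]; last first.
  by have := @noD D 0; rewrite !addr0; apply.
have dT : deg (ind [set: G]) = #|G|%:Z by rewrite deg_ind cardsT.
exists (ind setT) => //; apply/has_rankP => //; split.
  apply/survives1 => x; apply: effective_reaches; first exact: effective_ind.
  by rewrite ffunE inE.
by move=> /(@noD _ 1); rewrite dT; lia.
Qed.
End Rank.

(** * Firing sets of vertices *)

Section Firing.
Variable G : multigraph.
Implicit Types (D E F f g : divisor G) (A B T Z : {set G}) (x y z v w p : G).

Lemma indD1 A y : y \in A -> ind (A :\ y) = ind A - point y.
Proof.
move=> yA; apply/ffunP => u; rewrite !ffunE in_setD1.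
by case: (eqVneq u y) => [->|_] /=; rewrite ?yA ?subrr ?subr0.
Qed.

Lemma fire_effective E A : effective E ->
  (forall x, x \in A -> (out A x)%:Z <= E x) -> effective (E - lap (ind A)).
Proof.
move=> eE legal x; have -> : (E - lap (ind A)) x = E x - lap (ind A) x.
  by rewrite !ffunE.
rewrite lap_ind; case: ifP => [/legal|_]; first lia.
by have := eE x; lia.
Qed.

Lemma fire_gain E A x y : x \in A -> y \notin A -> (0 < mult y x)%N ->
  E y + 1 <= (E - lap (ind A)) y.
Proof.
move=> xA yA xy; have -> : (E - lap (ind A)) y = E y - lap (ind A) y.
  by rewrite !ffunE.
rewrite lap_ind (negbTE yA) (bigD1 x) //=; lia.
Qed.

Lemma fire_reaches E A x y : effective E ->
    (forall x, x \in A -> (out A x)%:Z <= E x) ->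
  x \in A -> y \notin A -> (0 < mult y x)%N -> reaches E y.
Proof.
move=> eE legal xA yA xy; exists (ind A); first exact: fire_effective.
by have := fire_gain E xA yA xy; have := eE y; lia.
Qed.

Lemma out_sub A B x : A \subset B -> (out B x <= out A x)%N.
Proof.
move=> /subsetP AB; rewrite /out [X in (_ <= X)%N](bigID (mem B)) /=.
rewrite addnC; apply: leq_trans (leq_addr _ _); rewrite leq_eqVlt; apply/orP; left.
apply/eqP/eq_bigl => u; case uB: (u \in B); rewrite ?andbF ?andbT //=.
by apply/esym/negP => /AB; rewrite uB.
Qed.

Lemma out_ge A x u : u \notin A -> (mult x u <= out A x)%N.
Proof. by move=> uA; rewrite /out (bigD1 u) //= leq_addr. Qed.

Lemma out_setC B x y : y \in B ->
  (forall z, z \in B -> (0 < mult x z)%N -> z = y) -> out (~: B) x = mult x y.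
Proof.
move=> yB cut; rewrite /out (bigD1 y) ?inE ?negbK //= big1 ?addn0 // => u.
rewrite inE negbK => /andP[uB uy]; apply/eqP; rewrite -leqn0 leqNgt.
by apply: contra uy => /(cut _ uB)->.
Qed.

(** The only way into [B] is its gate [y]. The effect of firing [B] is to send chips
from [y] to its neighbours outside [B], namely [p], by [c] edges, and [T], by one edge
per vertex. This is the exchange of chips between consecutive levels. *)
Lemma lap_pendant B T y p c :
    y \in B -> p \notin B -> p \notin T -> {in T, forall x, x \notin B} ->
    (forall x z, x \notin B -> z \in B -> (0 < mult x z)%N -> z = y) ->
    mult p y = c -> {in T, forall x, mult x y = 1%N} ->
    (forall x, x \notin B -> x \notin T -> x != p -> mult x y = 0%N) ->
  lap (ind B) = point y *+ (c + #|T|) - point p *+ c - ind T.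
Proof.
move=> yB pB pT TB cut pyc T1 rest0; apply/ffunP => x.
have -> : (point y *+ (c + #|T|) - point p *+ c - ind T) x =
   (point y *+ (c + #|T|)) x - (point p *+ c) x - (x \in T)%:Z by rewrite !ffunE.
rewrite lap_ind !pointMnE; case: ifP => [xB|/negbT xB].
  have xp : x == p = false by apply: contraNF pB => /eqP<-.
  have xT : x \in T = false by apply: contraTF xB => /TB.
  rewrite xp xT !subr0; case: eqP => [->|xy]; last first.
    rewrite /out big1 // => u uB; apply/eqP; rewrite -leqn0 leqNgt mult_sym.
    by apply/negP => /(cut _ _ uB xB).
  congr Posz; rewrite /out (bigD1 p) //= mult_sym pyc; congr addn.
  rewrite (bigID (mem T)) /= [X in (_ + X)%N]big1 ?addn0; last first.
    by move=> u /andP[/andP[uB up] uT]; rewrite mult_sym rest0.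
  rewrite -sum1_card; apply: eq_big => [u|u /andP[_ /T1]]; last by rewrite mult_sym.
  case uT: (u \in T); rewrite ?andbF ?andbT // (TB _ uT) /=.
  by apply: contraNneq pT => <-.
have -> : x == y = false by apply: contraNF xB => /eqP->.
rewrite (bigD1 y) //= big1 ?addn0; last first.
  move=> u /andP[uB uy]; apply/eqP; rewrite -leqn0 leqNgt.
  by apply: contra uy => /(cut _ _ xB uB)->.
case: eqP => [->|/eqP xp]; first by rewrite (negbTE pT) pyc; lia.
case xT: (x \in T); first by rewrite T1 //; lia.
by rewrite rest0 ?xT.
Qed.

Lemma connected_cut A x w : connected G -> x \in A -> w \notin A ->
  exists a b, [/\ a \in A, b \notin A & (0 < mult a b)%N].
Proof.
move=> [_ /(_ x w) cxw] xA wA; apply: NNPP => nocut; case/negP: wA.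
rewrite -(closed_connect _ cxw) // => a b ab.
apply/idP/idP => H; apply/negPn/negP => N; apply: nocut.
  by exists a, b.
by exists b, a; rewrite mult_sym.
Qed.

Lemma set_comprehension (Q : G -> Prop) : exists A, forall x, x \in A <-> Q x.
Proof.
have [x|b bP] := @fin_all_exists G (fun=> bool) (fun x b => b <-> Q x).
  by case: (classic (Q x)) => Qx; [exists true | exists false].
by exists [set x | b x] => x; rewrite inE.
Qed.

End Firing.

(** * Vertices attached to the core *)

Section Core.
Variable G : multigraph.
Implicit Types (D E F f g : divisor G) (A B L P T Y Z : {set G}).
Implicit Types (x y z v w p : G).

(** A part of the graph outside the core [L] that hangs from the rest by [p] only. *)
Record branch L p Z : Prop := Branch {
  branch_sub : Z \subset ~: L;
  branch_cut : forall x z, x \notin Z -> z \in Z -> (0 < mult x z)%N -> x = p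
}.

(** The invariant of the reconstruction: [L] is the set of the vertices placed so far
and [P] its last level. The portal is the member of [P] that turns out to be joined to
the next level, hence the conditions on all the members of [P]. By [core_conn], which
expresses that [L] is connected, no firing can split [L] where it has no chips. *)
Record core v L P : Prop := Core {
  core_sub : P \subset L;
  core_out : forall x z, x \in L -> z \notin L -> (0 < mult x z)%N -> x \in P;
  core_conn : forall A x, x \in A -> x \in L ->
    (forall y z, y \in A -> y \in L -> z \in L -> (0 < mult y z)%N -> z \in A) ->
    L \subset A;
  core_reach : forall p x, p \in P -> x \in L -> reaches (point p *+ #|L|) x;
  core_div : forall p, p \in P -> exists f,
    point p *+ #|L|.+1 + ind (~: L) = point v + ind setT - lap f;
  core_branch : forall w, w \notin L ->
    exists p Z, [/\ p \in P, w \in Z & branch L p Z]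
}.

(** What a firing towards [B] reveals: [y] is the gate of [B], and will be a member of
the next level, joined to [p] as the definition of quasi-banana graphs requires. *)
Record attached L P p B y : Prop := Attached {
  att_portal : p \in P;
  att_mem : y \in B;
  att_sub : B \subset ~: L;
  att_branch : exists2 Z, branch L p Z & y \in Z;
  att_cut : forall x z, x \notin B -> z \in B -> (0 < mult x z)%N -> z = y;
  att_mult : mult p y = #|L|.+1;
  att_simple : forall x, x \notin B -> x != p -> (mult x y <= 1)%N
}.

Hypothesis G_conn : connected G.
Hypothesis G_bound : pos_rank_deg_ge G #|G|%:Z.
Variables (v : G) (L P : {set G}).
Hypothesis v_rank2 : forall w, exists2 f,
  effective (point v + ind setT - lap f) & 2 <= (point v + ind setT - lap f) w.
Hypothesis coreL : core v L P.

Let subPL p : p \in P -> p \in L.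
Proof. exact: (subsetP (core_sub coreL)). Qed.

Let cardCL : (#|L| + #|~: L|)%N = #|G|.
Proof. exact: cardsC. Qed.

(** If a set can be fired when [p] has only [#|L|] chips, then the chip on the gaining
vertex [y] was superfluous: without it, a divisor of degree [#|G| - 1] has positive
rank. *)
Lemma no_single_fire p A x y : p \in P -> y \notin L ->
    x \in A -> y \notin A -> (0 < mult y x)%N ->
    (forall a, a \in A ->
       (out A a)%:Z <= (point p *+ #|L| + ind (~: L)) a) -> False.
Proof.
move=> pP yL xA yA xy legal.
have eE : effective (point p *+ #|L| + ind (~: L :\ y)).
  by apply: effectiveD; [apply: effective_pointMn | apply: effective_ind].
(* Too few chips for positive rank: some vertex cannot be reached. *)
have deg_lt : (#|L| + #|~: L :\ y| < #|G|)%N.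
  by rewrite -cardCL (cardsD1 y (~: L)) inE yL add1n addnS.
have := G_bound (D := point p *+ #|L| + ind (~: L :\ y)).
rewrite degD deg_pointMn deg_ind -PoszD lez_nat leqNgt deg_lt => bound.
suff: false by []; apply: bound => w; case: (boolP (w \in L)) => [wL|wL].
  by apply: reachesD; [apply: effective_ind | apply: core_reach coreL _ _ pP wL].
case: (eqVneq w y) => [->|wy].
  apply: (fire_reaches eE _ xA yA xy) => a aA; apply: le_trans (legal a aA) _.
  rewrite !ffunE in_setD1; case: eqP => [ay|_]; last exact: lexx.
  by move: yA; rewrite -ay aA.
apply: effective_reaches => //; rewrite ffunE pointMnE ffunE !inE wL wy /=.
by apply: ltr_wpDl => //; case: eqP.
Qed.

(** Two vertices which can receive a chip from equivalent divisors need not carry one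
of their own. With [p1 = p2] and [A1 = A2] this forbids a firing with two gaining
vertices; with two distinct sets it forbids independent firings. *)
Lemma no_double_fire p1 p2 A1 A2 x1 x2 y1 y2 :
    p1 \in P -> p2 \in P -> y1 \notin L -> y2 \notin L -> y1 != y2 ->
    x1 \in A1 -> y1 \notin A1 -> (0 < mult y1 x1)%N ->
    x2 \in A2 -> y2 \notin A2 -> (0 < mult y2 x2)%N ->
    (forall a, a \in A1 -> (out A1 a)%:Z <=
       (point p1 *+ #|L|.+1 + ind (~: L :\ y1 :\ y2)) a) ->
    (forall a, a \in A2 -> (out A2 a)%:Z <=
       (point p2 *+ #|L|.+1 + ind (~: L :\ y1 :\ y2)) a) -> False.
Proof.
move=> p1P p2P y1L y2L y12 x1A y1A xy1 x2A y2A xy2 legal1 legal2.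
set F := ind (~: L :\ y1 :\ y2) in legal1 legal2.
have eE p : effective (point p *+ #|L|.+1 + F).
  by apply: effectiveD; [apply: effective_pointMn | apply: effective_ind].
have deg_lt : (#|L|.+1 + #|~: L :\ y1 :\ y2| < #|G|)%N.
  rewrite -cardCL (cardsD1 y1 (~: L)) (cardsD1 y2 (~: L :\ y1)).
  by rewrite !inE y1L y2L eq_sym y12 add1n add1n !addnS addSn.
have := G_bound (D := point p1 *+ #|L|.+1 + F).
rewrite degD deg_pointMn deg_ind -PoszD lez_nat leqNgt deg_lt => bound.
suff: false by []; apply: bound => w; case: (boolP (w \in L)) => [wL|wL].
  rewrite mulrSr -addrA; apply: reachesD; last exact: core_reach coreL _ _ _ _.
  by apply: effectiveD; [apply: effective_point | apply: effective_ind].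
case: (eqVneq w y1) => [->|wy1]; first exact: fire_reaches (eE p1) _ x1A y1A xy1.
case: (eqVneq w y2) => [->|wy2]; last first.
  apply: effective_reaches => //; rewrite ffunE pointMnE ffunE !inE wL wy1 wy2 /=.
  by apply: ltr_wpDl => //; case: eqP.
have [f1 E1] := core_div coreL p1P; have [f2 E2] := core_div coreL p2P.
apply: (@reaches_lap _ _ (f2 - f1)).
suff -> : point p1 *+ #|L|.+1 + F - lap (f2 - f1) = point p2 *+ #|L|.+1 + F.
  exact: fire_reaches (eE p2) _ x2A y2A xy2.
have FE p : point p *+ #|L|.+1 + F =
    point p *+ #|L|.+1 + ind (~: L) - point y1 - point y2.
  rewrite /F !indD1 ?inE ?y1L // ?y2L ?[y2 == _]eq_sym ?y12 //.
  by rewrite !addrA.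
by rewrite !FE E1 E2 raddfB; apply/ffunP => u; rewrite !ffunE; ring.
Qed.

(** Such a set [A] could be fired with a single chip per vertex. If some chip moves to a
vertex outside [L], the chip there is superfluous; if it moves to [b] in [P], one of
the [#|L|] chips that are needed on [b] is. *)
Lemma no_inward_fire A w : w \in A -> A \subset ~: L ->
  (forall a, a \in A -> (out A a <= 1)%N) -> False.
Proof.
move=> wA /subsetP AL legal; have := AL _ wA; rewrite inE => wL.
have [p [_ [pP _ _]]] := core_branch coreL wL.
have pA : p \notin A by apply/negP => /AL; rewrite inE subPL.
have [a [b [aA bA ab]]] := connected_cut G_conn wA pA.
case: (boolP (b \in L)) => [bL|bL]; last first.
  apply: (no_single_fire pP bL aA bA); first by rewrite mult_sym.
  move=> c cA; rewrite ffunE pointMnE ffunE AL //.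
  by apply: ler_wpDl; rewrite ?lez_nat ?legal //; case: eqP.
have := AL _ aA; rewrite inE => aL.
have bP : b \in P by apply: (core_out coreL bL aL); rewrite mult_sym.
have L0 : (0 < #|L|)%N by apply/card_gt0P; exists b.
pose E : divisor G := point b *+ #|L|.-1 + ind (~: L).
have eE : effective E.
  by apply: effectiveD; [apply: effective_pointMn | apply: effective_ind].
have legalE c : c \in A -> (out A c)%:Z <= E c.
  move=> cA; rewrite ffunE pointMnE ffunE AL //.
  by apply: ler_wpDl; rewrite ?lez_nat ?legal //; case: eqP.
have deg_lt : (#|L|.-1 + #|~: L| < #|G|)%N by rewrite -cardCL ltn_add2r prednK.
have := G_bound (D := E).
rewrite degD deg_pointMn deg_ind -PoszD lez_nat leqNgt deg_lt => bound.
suff: false by []; apply: bound => u; case: (boolP (u \in L)) => [uL|uL]; last first.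
  apply: effective_reaches => //; rewrite ffunE pointMnE ffunE inE uL /=.
  by apply: ltr_wpDl => //; case: eqP.
apply: (@reaches_lap _ _ (ind A)).
have -> : E - lap (ind A) = point b *+ #|L| + (E - lap (ind A) - point b *+ #|L|).
  by rewrite [RHS]addrC subrK.
apply: reachesD; last exact: core_reach coreL _ _ _ _.
have eE1 : effective (E - lap (ind A)) by apply: fire_effective.
move=> z; have -> : (E - lap (ind A) - point b *+ #|L|) z =
  (E - lap (ind A)) z - (point b *+ #|L|) z by rewrite !ffunE.
rewrite pointMnE; case: eqP => [->|_]; last by rewrite subr0.
rewrite mult_sym in ab; rewrite subr_ge0; apply: le_trans (fire_gain E aA bA ab).
by rewrite [E b]ffunE pointMnE ffunE eqxx inE bL addr0 -PoszD addn1 prednK.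
Qed.

(** Take a potential [f] that brings two chips to [w]; the set on which [f] is maximal can
be fired first. It contains [p]: otherwise it would avoid [L], whose other vertices have
no chips, against [no_inward_fire]. As the branch [Z] meets the rest only at [p], the
complement of [Z] can be added to that set at no cost. *)
Lemma legal_towards p w Z : p \in P -> w \in Z -> branch L p Z ->
  exists A, [/\ w \notin A, ~: Z \subset A, (out A p <= #|L|.+1)%N,
    forall x, x \in A -> x \in Z -> (out A x <= 1)%N &
    forall x, x \in A -> x \notin Z -> x != p -> out A x = 0%N].
Proof.
move=> pP wZ [ZL Zcut]; have [f0 ef0 f0w] := v_rank2 w.
have ZnL x : x \in Z -> x \notin L by move=> /(subsetP ZL); rewrite inE.
have [f1 Ef1] := core_div coreL pP.
set X := _ + _ in Ef1; pose f := f0 - f1.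
have Xf : X - lap f = point v + ind setT - lap f0.
  by rewrite Ef1 raddfB; apply/ffunP => u; rewrite !ffunE; ring.
rewrite -Xf in ef0 f0w.
have XE x : X x = (if x == p then #|L|.+1%:Z else 0) + (x \notin L)%:Z.
  by rewrite ffunE pointMnE ffunE inE.
have XfE x : (X - lap f) x = X x - lap f x by rewrite !ffunE.
have [x0 fx0] : exists x0, forall y, f y <= f x0.
  have [x0 _ fx0] := @Order.TotalTheory.arg_maxP _ _ _ w xpredT f isT.
  by exists x0 => y; apply: fx0.
pose A0 := [set x | f x == f x0].
have outA0 x : x \in A0 -> (out A0 x)%:Z <= lap f x.
  rewrite inE => /eqP fx; rewrite /out PoszSum ffunE [X in _ <= X](bigID (mem A0)) /=.
  apply: ler_wpDl.
    by apply: sumr_ge0 => u _; rewrite mulr_ge0 // subr_ge0 fx.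
  apply: ler_sum => u; rewrite inE => fu.
  rewrite -[leLHS]mulr1 ler_wpM2l // fx -[1]add0r lezD1 subr_gt0.
  by rewrite lt_neqAle fu fx0.
have outX x : x \in A0 -> (out A0 x)%:Z <= X x.
  by move=> /outA0; have := ef0 x; rewrite XfE; lia.
have wA0 : w \notin A0.
  apply/negP => /outA0; move: f0w; rewrite XfE XE.
  case: eqP => [wp|_]; first by have := ZnL _ wZ; rewrite wp subPL.
  by case: (w \in L) => /=; lia.
have x0A0 : x0 \in A0 by rewrite inE.
have pA0 : p \in A0.
  apply/negPn/negP => pA0.
  have X0 x : x \in A0 -> X x = (x \notin L)%:Z.
    by move=> xA0; rewrite XE; case: eqP => [xp|]; rewrite ?add0r // -xp xA0 in pA0.
  case: (pickP (fun x => (x \in A0) && (x \in L))) => [x /andP[xA0 xL]|A0L].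
    have /subsetP/(_ p) : L \subset A0.
      apply: (core_conn coreL xA0 xL) => y z yA0 yL zL yz.
      apply/negPn/negP => zA0; have := outX y yA0.
      rewrite X0 // yL lez_nat leqn0 => /eqP out0.
      by have := out_ge y zA0; rewrite out0 leqNgt yz.
    by rewrite subPL // (negbTE pA0) => /(_ isT).
  apply: (no_inward_fire x0A0).
    by apply/subsetP => x xA0; rewrite inE; have := A0L x; rewrite /= xA0 /= => ->.
  move=> a aA0; have := outX a aA0; rewrite X0 // lez_nat => /leq_trans->//.
  exact: leq_b1.
have A0A : A0 \subset A0 :|: ~: Z by apply: subsetUl.
exists (A0 :|: ~: Z); split.
- by rewrite !inE negb_or negbK wZ andbT; rewrite inE in wA0.
- exact: subsetUr.
- have := outX p pA0; rewrite XE eqxx (subPL pP) addr0 lez_nat.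
  exact: leq_trans (out_sub p A0A).
- move=> x; rewrite in_setU in_setC => /orP[xA0|/negP//] xZ.
  have := outX x xA0; rewrite XE ZnL // => outx.
  move: outx; case: eqP => [xp|_]; last first.
    by rewrite add0r lez_nat; apply: leq_trans (out_sub x A0A).
  by have := ZnL x xZ; rewrite xp subPL.
- move=> x _ xZ xp; rewrite /out big1 // => u.
  rewrite in_setU in_setC negb_or negbK => /andP[_ uZ].
  by apply/eqP; rewrite -leqn0 leqNgt; apply: contra xp => /(Zcut _ _ xZ uZ)->.
Qed.

(** [B] is the complement of the set [A] given by [legal_towards]. When [A] is fired, [p]
loses exactly [#|L| + 1] chips by [no_single_fire], and by [no_double_fire] all the
edges that leave [A] end at one vertex [y]. *)
Lemma attached_exists w : w \notin L -> exists p B y, w \in B /\ attached L P p B y.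
Proof.
move=> wL; have [p [Z [pP wZ brZ]]] := core_branch coreL wL.
have [A [wA /subsetP ZA outp outZ outnZ]] := legal_towards pP wZ brZ.
have [ZL Zcut] := brZ.
have ZnL x : x \in Z -> x \notin L by move=> /(subsetP ZL); rewrite inE.
have AZ x : x \notin A -> x \in Z by apply: contraR => xZ; apply: ZA; rewrite inE.
have pZ : p \notin Z by apply/negP => /ZnL; rewrite subPL.
have pA : p \in A by apply: ZA; rewrite inE.
have [x [y [xA yA xy]]] := connected_cut G_conn pA wA.
have yZ := AZ _ yA; have yL := ZnL _ yZ.
have outp_eq : out A p = #|L|.+1.
  apply/eqP; rewrite eqn_leq outp ltnNge; apply/negP => outp'.
  apply: (no_single_fire pP yL xA yA); first by rewrite mult_sym.
  move=> a aA; rewrite ffunE pointMnE ffunE inE.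
  case: (eqVneq a p) => [->|ap].
    by rewrite subPL // addr0 lez_nat -ltnS.
  case: (boolP (a \in Z)) => aZ; last by rewrite outnZ.
  by rewrite ZnL // add0r lez_nat outZ.
have cut a z : a \notin ~: A -> z \in ~: A -> (0 < mult a z)%N -> z = y.
  rewrite !inE negbK => aA zA az; apply/eqP/negPn/negP => zy.
  have zL := ZnL _ (AZ _ zA).
  have legal b : b \in A ->
      (out A b)%:Z <= (point p *+ #|L|.+1 + ind (~: L :\ z :\ y)) b.
    move=> bA; rewrite ffunE pointMnE ffunE !in_setD1 inE.
    case: (eqVneq b p) => [->|bp]; first by rewrite outp_eq lerDl.
    case: (boolP (b \in Z)) => bZ; last by rewrite outnZ.
    rewrite ZnL // add0r.
    have -> : b != y by apply: contraNneq yA => <-.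
    have -> : b != z by apply: contraNneq zA => <-.
    exact: outZ.
  apply: (no_double_fire pP pP zL yL zy aA zA _ xA yA _ legal legal);
    by rewrite mult_sym.
exists p, (~: A), y; split; first by rewrite inE.
have outE b : b \in A -> out A b = mult b y.
  move=> bA; rewrite -[A]setCK (out_setC (y := y)) ?inE // => z zA.
  by apply: cut; rewrite // inE bA.
split=> //; first by rewrite inE.
- by apply/subsetP => z; rewrite inE => /AZ/ZnL; rewrite inE.
- by exists Z.
- by rewrite -outE.
- move=> a; rewrite inE negbK => aA ap; rewrite -outE //.
  by case: (boolP (a \in Z)) => [/(outZ _ aA)//|aZ]; rewrite outnZ.
Qed.

Lemma attached_portal p B y x : attached L P p B y ->
  x \in L -> (0 < mult x y)%N -> x = p.
Proof.
case=> _ _ _ [Z [ZL Zcut] yZ] _ _ _ xL; apply: Zcut => //.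
by apply: contraL xL => /(subsetP ZL); rewrite inE.
Qed.

Lemma attached_out p B y a : attached L P p B y -> a \notin B ->
  out (~: B) a = mult a y.
Proof.
by move=> att aB; apply: out_setC (att_mem att) _ => z; apply: att_cut att _ _ aB.
Qed.

(** If [y] and [y'] were not adjacent, [y'] could give up its chip without preventing the
firing towards [y], and conversely, against [no_double_fire]. Once adjacent, they lie in
the same branch of the core, and this gives [p = p']. *)
Lemma attached_distinct p B y p' B' y' :
    attached L P p B y -> attached L P p' B' y' -> y != y' ->
  [/\ y' \notin B, p = p' & mult y y' = 1%N].
Proof.
move=> att att' yy'.
have notin q C z q' C' z' : attached L P q C z -> attached L P q' C' z' ->
    z != z' -> z' \notin C.
  move=> a a'; apply: contra => z'C; rewrite eq_sym; apply/eqP.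
  apply: (att_cut a (x := q') _ z'C); last by rewrite (att_mult a').
  have := subPL (att_portal a').
  by apply: contraL => /(subsetP (att_sub a)); rewrite inE.
have y'B := notin _ _ _ _ _ _ att att' yy'.
have yB' : y \notin B' by apply: notin att' att _; rewrite eq_sym.
have nL q C z : attached L P q C z -> z \notin L.
  by move=> a; have := subsetP (att_sub a) _ (att_mem a); rewrite inE.
have nC q C z x : attached L P q C z -> x \in L -> x \notin C.
  by move=> a; apply: contraL => /(subsetP (att_sub a)); rewrite inE.
have yL := nL _ _ _ att; have y'L := nL _ _ _ att'.
have mult_le1 : (mult y y' <= 1)%N.
  rewrite mult_sym; apply: (att_simple att) => //.
  by apply: contraNneq y'L => ->; apply: subPL (att_portal att).
have mult1 : mult y y' = 1%N.
  apply/eqP; rewrite eqn_leq mult_le1 lt0n; apply/negP => /eqP m0.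
  have legal q C z : attached L P q C z -> (mult y z = 0)%N -> (mult y' z = 0)%N ->
      forall a, a \in ~: C ->
      (out (~: C) a)%:Z <= (point q *+ #|L|.+1 + ind (~: L :\ y :\ y')) a.
    move=> at_ my my' a; rewrite inE => aC; rewrite (attached_out at_) //.
    rewrite ffunE pointMnE ffunE !in_setD1 inE.
    case: (eqVneq a q) => [->|aq]; first by rewrite (att_mult at_) lerDl.
    have := att_simple at_ aC aq.
    case: (eqVneq a y') => [->|]; first by rewrite my'.
    case: (eqVneq a y) => [->|]; first by rewrite my.
    case: (boolP (a \in L)) => [aL|_]; last by rewrite add0r.
    have [m|] := posnP (mult a z); first by rewrite m.
    by move/(attached_portal at_ aL)/eqP; rewrite (negbTE aq).
  have pL := subPL (att_portal att); have p'L := subPL (att_portal att').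
  apply: (@no_double_fire p p' (~: B) (~: B') p p' y y' (att_portal att)
     (att_portal att') yL y'L yy').
  - by rewrite inE (nC _ _ _ _ att).
  - by rewrite inE negbK (att_mem att).
  - by rewrite mult_sym (att_mult att).
  - by rewrite inE (nC _ _ _ _ att').
  - by rewrite inE negbK (att_mem att').
  - by rewrite mult_sym (att_mult att').
  - by apply: legal att _ _; rewrite ?mult_loopless // mult_sym.
  - by apply: legal att' _ _; rewrite ?mult_loopless.
split=> //; have [Z [ZL Zcut] yZ] := att_branch att.
have y'Z : y' \in Z.
  apply/negPn/negP => y'Z; have := Zcut y' y y'Z yZ.
  rewrite mult_sym mult1 => /(_ isT) y'p.
  by rewrite y'p subPL // (att_portal att) in y'L.
apply/esym; apply: Zcut y'Z _; last by rewrite (att_mult att').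
have := subPL (att_portal att').
by apply: contraL => /(subsetP ZL); rewrite inE.
Qed.
End Core.

(** * Adding a level to the core *)

Section CoreStep.
Variable G : multigraph.
Implicit Types (D E F f g : divisor G) (A B L P T Y Z : {set G}).
Implicit Types (x y z v w p : G).
Hypothesis G_conn : connected G.
Hypothesis G_bound : pos_rank_deg_ge G #|G|%:Z.
Variables (v : G) (L P : {set G}).
Hypothesis v_rank2 : forall w, exists2 f,
  effective (point v + ind setT - lap f) & 2 <= (point v + ind setT - lap f) w.
Hypothesis coreL : core v L P.

(** The next level [Y] consists of all the attached vertices. For [y] in [Y] the union
[U y] of all the branches attached at [y] is used, because a single one may leave out
some of the neighbours of [y]: with the union, the neighbours of [y] outside [U y] are
exactly [p0] and the rest of [Y], so that firing [U y] exchanges chips between the two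
levels. *)
Lemma core_step w0 : w0 \notin L -> exists p0 Y,
  [/\ p0 \in P, exists y, y \in Y, Y \subset ~: L,
      forall x y, x \in L -> y \in Y ->
        mult x y = if x == p0 then #|L|.+1 else 0%N
    & (forall y y', y \in Y -> y' \in Y -> mult y y' = (y != y')) /\
      core v (L :|: Y) Y].
Proof.
move=> w0L.
have subPL p : p \in P -> p \in L by apply: (subsetP (core_sub coreL)).
have cover := attached_exists G_conn G_bound v_rank2 coreL.
have distinct := attached_distinct G_bound coreL.
have [Y YP] := set_comprehension (fun y => exists p B, attached L P p B y).
have [p0 [B0 [y0 [_ att0]]]] := cover _ w0L.
have p0P := att_portal att0.
have portal p B y : attached L P p B y -> p = p0.
  move=> att; have [yy0|/(distinct _ _ _ _ _ _ att att0)[]//] := eqVneq y y0.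
  apply: (attached_portal att0); first exact: subPL (att_portal att).
  by rewrite -yy0 (att_mult att).
have attY y : y \in Y -> exists B, attached L P p0 B y.
  by move=> /YP[p [B att]]; exists B; rewrite -(portal _ _ _ att).
have YL y : y \in Y -> y \notin L.
  by move=> /attY[B att]; have := subsetP (att_sub att) _ (att_mem att); rewrite inE.
have multLY x y : x \in L -> y \in Y -> mult x y = if x == p0 then #|L|.+1 else 0%N.
  move=> xL /attY[B att]; case: eqP => [->|xp]; first exact: att_mult att.
  have [//|m] := posnP (mult x y).
  by case: xp; apply: attached_portal att xL m.
have multYY y y' : y \in Y -> y' \in Y -> mult y y' = (y != y').
  move=> /attY[B att] /attY[B' att'].
  by have [->|/(distinct _ _ _ _ _ _ att att')[]//] := eqVneq; rewrite mult_loopless.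
have [U UP] := fin_all_exists (fun y =>
  set_comprehension (fun x => exists p B, attached L P p B y /\ x \in B)).
have memU y : y \in Y -> y \in U y.
  by move=> /attY[B att]; apply/UP; exists p0, B; split=> //; apply: att_mem att.
have UL y x : x \in U y -> x \notin L.
  by move=> /UP[p [B [att xB]]]; have := subsetP (att_sub att) _ xB; rewrite inE.
have notU y x p B : x \notin U y -> attached L P p B y -> x \notin B.
  by move=> xU att; apply: contra xU => xB; apply/UP; exists p, B.
have cutU y x z : x \notin U y -> z \in U y -> (0 < mult x z)%N -> z = y.
  move=> xU /UP[p [B [att zB]]]; apply: (att_cut att) => //; exact: notU att.
have coverU w : w \notin L -> exists2 y, y \in Y & w \in U y.
  move=> /cover[p [B [y [wB att]]]]; exists y; first by apply/YP; exists p, B.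
  by apply/UP; exists p, B.
have distinctU y y' : y \in Y -> y' \in Y -> y != y' -> y' \notin U y.
  move=> _ /attY[B' att'] yy'; apply/negP => /UP[p [B [att y'B]]].
  by have [] := distinct _ _ _ _ _ _ att att' yy'; rewrite y'B.
have restU y x : y \in Y -> x \notin U y -> x \notin Y :\ y -> x != p0 ->
    mult x y = 0%N.
  move=> yY xU; rewrite in_setD1 negb_and negbK => xY xp.
  case: (boolP (x \in L)) => xL; first by rewrite multLY // (negbTE xp).
  have [y' y'Y xU'] := coverU _ xL.
  have yy' : y' != y by apply: contraNneq xU => <-.
  case: (posnP (mult x y)) => //; rewrite mult_sym.
  move/(cutU _ _ _ (distinctU _ _ y'Y yY yy') xU') => xy'.
  by move: xY; rewrite xy' y'Y (negbTE yy').
have cardLY : #|L :|: Y| = (#|L| + #|Y|)%N.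
  rewrite cardsU; suff -> : L :&: Y = set0 by rewrite cards0 subn0.
  by apply/setP => x; rewrite !inE; apply/andP => -[xL /YL]; rewrite xL.
have cardLY' y : y \in Y -> #|L :|: Y| = (#|L|.+1 + #|Y :\ y|)%N.
  by move=> yY; rewrite cardLY (cardsD1 y Y) yY addnA addn1.
have lapU y : y \in Y -> lap (ind (U y)) =
    point y *+ #|L :|: Y| - point p0 *+ #|L|.+1 - ind (Y :\ y).
  move=> yY; rewrite (cardLY' y yY); apply: lap_pendant.
  - exact: memU.
  - by apply: contraL (subPL _ p0P) => /UL.
  - by rewrite in_setD1 negb_and; apply/orP; right;
      apply: contraL (subPL _ p0P) => /YL.
  - move=> x; rewrite in_setD1 => /andP[xy xY].
    by apply: distinctU => //; rewrite eq_sym.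
  - exact: cutU.
  - by rewrite multLY ?subPL // eqxx.
  - by move=> x; rewrite in_setD1 => /andP[xy xY]; rewrite multYY // xy.
  - by move=> x; apply: restU.
exists p0, Y; split=> //; last split=> //.
- by exists y0; apply/YP; exists p0, B0.
- by apply/subsetP => y /YL; rewrite inE.
split.
- exact: subsetUr.
- move=> x z; rewrite !in_setU negb_or => /orP[xL|//] /andP[zL zY] xz.
  have [y yY zU] := coverU _ zL.
  have xU : x \notin U y by apply: contraL xL => /UL.
  by move: zY; rewrite (cutU _ _ _ xU zU xz) yY.
- move=> A x xA xLY closed.
  have LA y : y \in A -> y \in L -> L \subset A.
    move=> yA yL; apply: (core_conn coreL yA yL) => a b aA aL bL.
    by apply: closed => //; rewrite in_setU ?aL ?bL.
  have p0A : p0 \in A.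
    move: xLY; rewrite in_setU => /orP[xL|xY].
      exact: (subsetP (LA _ xA xL)) (subPL _ p0P).
    apply: (closed x) => //; rewrite ?in_setU ?xY ?orbT ?subPL //.
    by rewrite mult_sym multLY ?subPL // eqxx.
  rewrite subUset (LA _ p0A (subPL _ p0P)); apply/subsetP => y yY.
  apply: (closed p0) => //; rewrite ?in_setU ?yY ?orbT ?subPL //.
  by rewrite multLY ?subPL // eqxx.
- move=> y x yY xLY; have [->|xy] := eqVneq x y.
    apply: effective_reaches; first exact: effective_pointMn.
    by rewrite pointMnE eqxx (cardLY' y yY).
  apply: (@reaches_lap _ _ (ind (U y))).
  have -> : point y *+ #|L :|: Y| - lap (ind (U y)) =
      point p0 *+ #|L|.+1 + ind (Y :\ y).
    by rewrite lapU // !opprB !addrA [_ + ind _]addrC; apply/ffunP => u;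
       rewrite !ffunE; ring.
  have eYy := effective_ind (Y :\ y).
  case: (boolP (x \in L)) => xL.
    rewrite mulrSr -addrA; apply: reachesD; last exact: core_reach coreL _ _ p0P xL.
    exact: effectiveD (effective_point _) _.
  apply: effective_reaches.
    by apply: effectiveD; [apply: effective_pointMn|].
  rewrite ffunE pointMnE ffunE in_setD1 xy; move: xLY.
  by rewrite in_setU (negbTE xL) /= => ->; apply: ltr_wpDl => //; case: eqP.
- move=> y yY; have [f Ef] := core_div coreL p0P; exists (f - ind (U y)).
  rewrite raddfB /= opprD opprK addrA -Ef lapU //.
  apply/ffunP => u; rewrite mulrSr !ffunE !inE.
  have [->|_] := eqVneq u y; first by rewrite yY (negbTE (YL _ yY)) /=; ring.
  by case: (boolP (u \in Y)) => [/YL/negbTE->|_] /=; rewrite ?orbF; ring.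
- move=> w; rewrite in_setU negb_or => /andP[wL wY].
  have [y yY wU] := coverU _ wL; exists y, (U y :\ y); split=> //.
    by rewrite in_setD1 wU andbT; apply: contraNneq wY => ->.
  split=> [|x z].
    apply/subsetP => z; rewrite in_setD1 in_setC in_setU negb_or => /andP[zy zU].
    rewrite (UL _ _ zU); apply: contraL zU => zY; apply: distinctU => //.
    by rewrite eq_sym.
  rewrite !in_setD1 negb_and negbK => /orP[/eqP//|xU] /andP[zy zU] xz.
  by rewrite (cutU _ _ _ xU zU xz) eqxx in zy.
Qed.
End CoreStep.

(** * Layered graphs *)

Section Layering.
Variable G : multigraph.
Implicit Types (D E F f g : divisor G) (A B L P T Y Z : {set G}).
Implicit Types (x y z v w : G) (lev : G -> nat) (p : nat -> G).

Definition below lev i : {set G} := [set z | (lev z <= i)%N].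

Definition layer_step lev p x y : nat :=
  if (lev y == (lev x).+1) && (x == p (lev x)) then #|below lev (lev x)|.+1
  else 0.

Definition layer_mult lev p x y : nat :=
  ((lev x == lev y) && (x != y)) + layer_step lev p x y + layer_step lev p y x.

(** The structure of a quasi-banana graph without the indices inside the levels:
[p i] plays the part of the vertex u_{i,1}. As [below lev i] includes the single
vertex of level 0, the multiplicity [#|below lev i|.+1] is the sum of the sizes of
levels 1 to [i], plus 2. *)
Record layering m lev p : Prop := Layering {
  layer_le : forall x, (lev x <= m)%N;
  layer_portal : forall i, (i <= m)%N -> lev (p i) = i;
  layer_root : forall x y, lev x = 0%N -> lev y = 0%N -> x = y;
  layer_multE : forall x y, mult x y = layer_mult lev p x y
}.

Lemma layer_multC lev p x y : layer_mult lev p x y = layer_mult lev p y x.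
Proof. by rewrite /layer_mult addnAC [lev x == _]eq_sym [x == y]eq_sym. Qed.

Lemma root_div v :
  point v *+ #|[set v]|.+1 + ind (~: [set v]) = point v + ind setT.
Proof.
apply/ffunP => x; rewrite cards1 mulr2n !ffunE !inE.
by case: (x == v).
Qed.

Lemma core_root v : core v [set v] [set v].
Proof.
split=> //.
- by move=> A x xA /set1P xv _; rewrite sub1set -xv.
- move=> p x /set1P-> /set1P->; rewrite cards1 mulr1n.
  by apply: effective_reaches; [apply: effective_point | rewrite ffunE eqxx].
- by move=> p /set1P->; exists 0; rewrite raddf0 subr0 root_div.
- move=> w wv; exists v, (~: [set v]); split; rewrite ?set11 ?inE //.
    by rewrite inE in wv.
  by split=> // x z; rewrite !inE negbK => /eqP.
Qed.

(** Levels are added to the core [below lev i] until it is the whole graph. The value of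
[lev] outside the core is irrelevant as long as it exceeds [i], and so is the choice of
[p i] in its level, which is settled only when level [i + 1] is known. *)
Lemma core_layering v : connected G -> pos_rank_deg_ge G #|G|%:Z ->
  (forall w, exists2 f, effective (point v + ind setT - lap f) &
     2 <= (point v + ind setT - lap f) w) ->
  exists m lev p, layering m lev p.
Proof.
move=> conn bound rank2.
suff: forall n i lev p, (#|~: below lev i| <= n)%N ->
    core v (below lev i) [set x | lev x == i] ->
    (forall k, (k <= i)%N -> lev (p k) = k) ->
    (forall x y, lev x = 0%N -> lev y = 0%N -> x = y) ->
    {in below lev i &, forall x y, mult x y = layer_mult lev p x y} ->
  exists m lev p, layering m lev p.
  pose lev x := (x != v : nat).
  have b0 : below lev 0 = [set v].
    by apply/setP => x; rewrite !inE /lev; case: (x == v).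
  have P0 : [set x | lev x == 0%N] = [set v].
    by apply/setP => x; rewrite !inE /lev; case: (x == v).
  have lev0 x : lev x = 0%N -> x = v by rewrite /lev; case: eqP.
  move/(_ #|~: below lev 0| 0%N lev (fun=> v) (leqnn _)); apply.
  - by rewrite b0 P0; apply: core_root.
  - by case=> // _; rewrite /lev eqxx.
  - by move=> x y /lev0-> /lev0->.
  - rewrite b0 => x y /set1P-> /set1P->.
    by rewrite mult_loopless /layer_mult /layer_step eqxx /lev eqxx.
elim=> [|n IH] i lev p cardn coreL portals root multL.
  exists i, lev, p; have all_in x : x \in below lev i.
    apply/negPn/negP => xL; move: cardn; rewrite leqNgt => /negP; apply.
    by apply/card_gt0P; exists x; rewrite inE.
  split=> // [x|x y]; last by apply: multL.
  by have := all_in x; rewrite inE.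
case: (pickP (mem (~: below lev i))) => [w0 /=|noout]; last first.
  apply: (IH i lev p) => //; suff -> : ~: below lev i = set0 by rewrite cards0.
  by apply/setP => x; have := noout x; rewrite /= in_set0.
rewrite in_setC => w0L.
have [p0 [Y [p0P [y0 y0Y] YL multLY [multYY coreLY]]]] :=
  core_step conn bound rank2 coreL w0L.
set L := below lev i in YL multLY coreLY w0L cardn coreL multL.
have YnL y : y \in Y -> y \notin L by move=> /(subsetP YL); rewrite inE.
pose lev' x := if x \in L then lev x else if x \in Y then i.+1 else i.+2.
pose p' k := if k == i then p0 else if k == i.+1 then y0 else p k.
have Llev x : x \in L -> (lev x <= i)%N by rewrite inE.
have lev'L x : x \in L -> lev' x = lev x by rewrite /lev' => ->.
have lev'Y x : x \in Y -> lev' x = i.+1.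
  by move=> xY; rewrite /lev' (negbTE (YnL _ xY)) xY.
have lev'_le x k : (k <= i)%N -> (lev' x <= k)%N = (lev x <= k)%N.
  move=> ki; rewrite /lev'; case: ifP => // xL; have : (i < lev x)%N.
    by rewrite ltnNge; apply/negP => xi; rewrite inE xi in xL.
  move=> ix; rewrite [RHS]leqNgt (leq_ltn_trans ki ix) /=.
  by case: ifP => _; rewrite leqNgt ltnS ?(leq_trans ki (leqnSn i)) ?ki.
have below_eq k : (k <= i)%N -> below lev' k = below lev k.
  by move=> ki; apply/setP => x; rewrite !inE lev'_le.
have below_LY : below lev' i.+1 = L :|: Y.
  apply/setP => x; rewrite in_setU inE /lev'; case: ifP => [/Llev/leqW->|_] //=.
  by case: ifP; rewrite ?leqnn ?ltnn.
have layer_Y : [set x | lev' x == i.+1] = Y.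
  apply/setP => x; rewrite inE /lev'; case: ifP => [xL|_].
    rewrite ltn_eqF ?ltnS ?Llev //; apply/esym/negP => /YnL; by rewrite xL.
  by case: ifP; rewrite ?eqxx // gtn_eqF.
have lev_p0 : lev p0 = i by move: p0P; rewrite inE => /eqP.
have p0L : p0 \in L by rewrite inE lev_p0.
apply: (IH i.+1 lev' p').
- rewrite below_LY -ltnS; apply: leq_trans cardn; apply: proper_card.
  apply/properP; split; first by rewrite setCS subsetUl.
  by exists y0; rewrite !in_setC ?in_setU ?y0Y ?orbT // YnL.
- by rewrite below_LY layer_Y.
- move=> k; rewrite /p' => ki; case: eqP => [->|/eqP kni]; first by rewrite lev'L.
  case: eqP => [->|/eqP kni1]; first exact: lev'Y.
  have ki' : (k <= i)%N by rewrite -ltnS ltn_neqAle kni1.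
  by rewrite lev'L ?inE portals.
- move=> x y; rewrite /lev'; case: ifP => [_|_]; last by case: ifP.
  by move=> x0; case: ifP => [_|_]; [apply: root | case: ifP].
have stepL x y : x \in L -> y \in L -> layer_step lev' p' x y = layer_step lev p x y.
  move=> xL yL; rewrite /layer_step !lev'L //; case: eqP => //= yx.
  have xi : (lev x < i)%N by rewrite -yx Llev.
  by rewrite /p' (ltn_eqF xi) (ltn_eqF (leqW xi)) below_eq // ltnW.
have stepLY x y : x \in L -> y \in Y ->
    layer_step lev' p' x y = if x == p0 then #|L|.+1 else 0%N.
  move=> xL yY; rewrite /layer_step (lev'L x) // (lev'Y y) // eqSS eq_sym.
  case: (eqVneq x p0) => [->|xp0]; first by rewrite lev_p0 eqxx /p' !eqxx below_eq.
  by case: eqP => //= ->; rewrite /p' eqxx (negbTE xp0).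
have stepYL x y : x \in Y -> y \in L -> layer_step lev' p' x y = 0%N.
  move=> xY yL; rewrite /layer_step (lev'Y x) // (lev'L y) // ltn_eqF //.
  by rewrite ltnS leqW // Llev.
have multLY' x y : x \in L -> y \in Y -> mult x y = layer_mult lev' p' x y.
  move=> xL yY; rewrite multLY // /layer_mult stepLY // stepYL // addn0.
  by rewrite (lev'L x) // (lev'Y y) // ltn_eqF // ltnS Llev.
move=> x y; rewrite below_LY !in_setU => /orP[xL|xY] /orP[yL|yY].
- by rewrite multL // /layer_mult !stepL // !lev'L.
- exact: multLY'.
- by rewrite mult_sym layer_multC multLY'.
- rewrite multYY // /layer_mult /layer_step !lev'Y // eqxx.
  by rewrite [i.+1 == i.+2]ltn_eqF //= !addn0.
Qed.

End Layering.

(** * Gonality of layered graphs *)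

Section LayeringGonality.
Variables (G : multigraph) (m : nat) (lev : G -> nat) (p : nat -> G).
Hypothesis layered : layering m lev p.
Implicit Types (D E F f g : divisor G) (A B L P T Y Z : {set G}).
Implicit Types (x y z v w : G).

Definition layer i : {set G} := [set x | lev x == i].

Let lev_p i : (i <= m)%N -> lev (p i) = i.
Proof. exact: (layer_portal layered). Qed.

Lemma mult_same x y : lev x = lev y -> x != y -> mult x y = 1%N.
Proof.
move=> xy nxy; rewrite (layer_multE layered) /layer_mult /layer_step xy eqxx nxy.
by rewrite ltn_eqF.
Qed.

Lemma mult_next x i : lev x = i.+1 -> mult (p i) x = #|below lev i|.+1.
Proof.
move=> xi; have lp : lev (p i) = i.
  by apply: lev_p; apply: leq_trans (layer_le layered x); rewrite xi.
rewrite (layer_multE layered) /layer_mult /layer_step xi lp !eqxx.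
by rewrite ltn_eqF // [i == i.+2]ltn_eqF //= addn0.
Qed.

Variant adj_spec x y : Prop :=
| AdjSame of lev x = lev y & x != y
| AdjUp of lev y = (lev x).+1 & x = p (lev x)
| AdjDown of lev x = (lev y).+1 & y = p (lev y).

Lemma adjP x y : (0 < mult x y)%N -> adj_spec x y.
Proof.
rewrite (layer_multE layered) /layer_mult /layer_step.
case: (boolP ((lev x == lev y) && (x != y))) => [/andP[/eqP ? ?] _|_].
  exact: AdjSame.
move=> m_gt0; case: (boolP ((lev y == (lev x).+1) && (x == p (lev x)))) m_gt0.
  by move=> /andP[/eqP ? /eqP ?] _; apply: AdjUp.
case: (boolP ((lev x == (lev y).+1) && (y == p (lev y)))) => //.
by move=> /andP[/eqP ? /eqP ?] _ _; apply: AdjDown.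
Qed.

Lemma card_belowS i : #|below lev i.+1| = (#|below lev i| + #|layer i.+1|)%N.
Proof.
rewrite -(cardsID (below lev i) (below lev i.+1)); congr addn; apply: eq_card => x.
  by rewrite !inE; case: (leqP (lev x) i) => [/leqW->|]; rewrite ?andbF.
by rewrite !inE -ltnNge [RHS]eqn_leq andbC.
Qed.

(** By induction on the level of [w]: fire every vertex except [w] and the levels that
hang from it. The portal below spends all the chips it has gathered, and the rest of the
level of [w] spends its single chips. *)
Lemma layer_div w : exists f,
  point w *+ #|below lev (lev w)|.+1 + ind (~: below lev (lev w)) =
  point (p 0) + ind setT - lap f.
Proof.
move lw: (lev w) => i; elim: i w lw => [|i IH] w lw.
  have -> : below lev 0 = [set w].
    apply/setP => x; rewrite !inE leqn0; apply/eqP/eqP => [x0|->//].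
    by apply: (layer_root layered); rewrite ?x0 ?lw.
  have -> : p 0 = w by apply: (layer_root layered); rewrite ?lev_p.
  by exists 0; rewrite raddf0 subr0 root_div.
have im : (i < m)%N by rewrite -lw (layer_le layered).
have lpi : lev (p i) = i by rewrite lev_p // ltnW.
have [f Ef] := IH (p i) lpi.
pose B := w |: (if w == p i.+1 then ~: below lev i.+1 else set0).
pose T := layer i.+1 :\ w.
have BE x : (x \in B) = (x == w) || (w == p i.+1) && (i.+1 < lev x)%N.
  by rewrite !inE; case: (w == p i.+1); rewrite !inE // -ltnNge.
have cardB : #|below lev i.+1| = (#|below lev i|.+1 + #|T|)%N.
  by rewrite card_belowS (cardsD1 w (layer _)) inE lw eqxx addSnnS.
have lapB : lap (ind B) =
    point w *+ #|below lev i.+1| - point (p i) *+ #|below lev i|.+1 - ind T.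
  rewrite cardB; apply: lap_pendant.
  - by rewrite BE eqxx.
  - rewrite BE lpi [(i.+1 < i)%N]ltnNge ltnW ?leqnSn // andbF orbF.
    by apply/eqP => pw; move: lpi; rewrite pw lw => /eqP; rewrite gtn_eqF.
  - by rewrite !inE lpi ltn_eqF // andbF.
  - move=> x; rewrite BE !inE => /andP[xw /eqP->].
    by rewrite ltnn andbF orbF.
  - move=> x z; rewrite !BE negb_or => /andP[xw xB] /orP[/eqP//|/andP[/eqP wp zi]] xz.
    move: xB; rewrite -wp eqxx /= -leqNgt => xi.
    case: (adjP xz) => [xz'|zx xp|xz']; first by rewrite xz' leqNgt zi in xi.
      suff lx : lev x = i.+1 by rewrite xp lx wp eqxx in xw.
      by apply/eqP; rewrite eqn_leq xi -ltnS -zx.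
    by move: xi; rewrite xz' ltnNge (ltnW zi).
  - exact: mult_next.
  - by move=> x; rewrite !inE => /andP[xw /eqP lx]; rewrite mult_same // lx lw.
  - move=> x; rewrite BE !inE negb_or negb_and => /andP[xw xB] /=.
    rewrite xw /= => xi xp.
    case: (posnP (mult x w)) => // /adjP[lxw|lwx xp'|lxw wp].
    + by rewrite lxw lw eqxx in xi.
    + by move: lwx xp; rewrite lw => -[ix]; rewrite xp' -ix eqxx.
    + by move: xB; rewrite lxw -lw -wp eqxx ltnSn.
exists (f - ind B); rewrite raddfB /= opprD opprK addrA -Ef lapB.
apply/ffunP => u; rewrite mulrSr !ffunE !inE.
have [->|_] := eqVneq u w; first by rewrite lw leqnn ltnn /=; ring.
by rewrite -[(lev u <= i)%N]ltnS; case: ltngtP => _ /=; ring.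
Qed.

Lemma layering_rank2 w : exists2 f,
  effective (point (p 0) + ind setT - lap f) &
  2 <= (point (p 0) + ind setT - lap f) w.
Proof.
have [f Ef] := layer_div w; exists f; rewrite -Ef.
  by apply: effectiveD; [apply: effective_pointMn | apply: effective_ind].
have w0 : (0 < #|below lev (lev w)|)%N by apply/card_gt0P; exists w; rewrite inE.
by rewrite ffunE pointMnE eqxx ffunE !inE leqnn addr0 lez_nat.
Qed.

Lemma cut_sumC A :
  (\sum_(x in A) out A x = \sum_(x in ~: A) out (~: A) x)%N.
Proof.
rewrite /out exchange_big /=; apply: eq_big => [x|x _]; first by rewrite inE.
by apply: eq_big => [y|y _]; rewrite ?inE ?negbK // mult_sym.
Qed.

(** Let [k] be the number of vertices of level [i + 1] in [A]. Each has edges to the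
portal [p i] and to the vertices of its level outside [A], so at least [k * (N + 1 - k)]
edges leave [A], where [N = #|below lev i.+1|]. This is at least [N] since
[1 <= k <= N]. *)
Lemma cut_sum_ge A i x : lev x = i.+1 -> x \in A -> p i \notin A ->
  (#|below lev i.+1| <= \sum_(x in A) out A x)%N.
Proof.
move=> lx xA pA; have lp : lev (p i) = i.
  by apply: lev_p; apply: leq_trans (layer_le layered x); rewrite lx.
pose K := A :&: layer i.+1; pose K' := layer i.+1 :\: A.
apply: (@leq_trans (\sum_(x in K) out A x)); last first.
  rewrite [X in (_ <= X)%N](bigID (mem (layer i.+1))) /=.
  apply: leq_trans (leq_addr _ _); apply: eq_leq; apply: eq_bigl => y.
  by rewrite in_setI.
have outK y : y \in K -> (#|below lev i|.+1 + #|K'| <= out A y)%N.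
  rewrite !inE => /andP[yA /eqP ly].
  rewrite /out (bigD1 (p i)) //= mult_sym mult_next // leq_add2l.
  rewrite (bigID (mem (layer i.+1))) /=; apply: leq_trans (leq_addr _ _).
  rewrite -sum1_card; apply: eq_leq; apply: eq_big => [u|u].
    rewrite !inE; case: (boolP (lev u == i.+1)) => [lu|_]; rewrite ?andbF ?andbT //.
    suff -> : u != p i by rewrite andbT.
    by apply: contraTneq lu => ->; rewrite lp ltn_eqF.
  rewrite !inE => /andP[uA /eqP lu]; rewrite mult_same ?ly ?lu //.
  by apply: contraNneq uA => <-.
apply: (@leq_trans (\sum_(x in K) (#|below lev i|.+1 + #|K'|))); last exact: leq_sum.
rewrite sum_nat_const card_belowS -(cardsID A (layer i.+1)) -/K' [layer _ :&: A]setIC -/K.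
have : (0 < #|K|)%N by apply/card_gt0P; exists x; rewrite !inE xA lx eqxx.
move: #|K| #|K'| #|below lev i| => a b c; clear; case: a => // a _.
by nia.
Qed.

(** Every edge with an end on these levels joins vertices of equal potential: both ends
have the same portal below, or one end is the portal below the other. *)
Lemma lap_settled f j :
  (forall x, (j <= lev x)%N -> f x = f (p (lev x).-1)) ->
  forall x, (j <= lev x)%N -> lap f x = 0.
Proof.
move=> fp x jx; rewrite ffunE big1 // => u _.
case: (posnP (mult x u)) => [->|]; first by rewrite mul0r.
suff E : (0 < mult x u)%N -> f x = f u by move/E->; rewrite subrr mulr0.
case/adjP => [lxu _|lux xp|lxu up].
- by rewrite fp // lxu -fp // -lxu.
- by rewrite [RHS]fp lux ?(leqW jx) //= -xp.
- by rewrite fp // lxu /= -up.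
Qed.

(** Across each edge that leaves [A] the potential drops by at least one, so at least one
chip moves along it. *)
Lemma cut_flow_ge f A :
  (forall x y, x \in A -> y \notin A -> f y < f x) ->
  (\sum_(x in A) out A x)%N%:Z <= \sum_(x in A) lap f x.
Proof.
move=> fA; rewrite sum_lap PoszSum; apply: ler_sum => x xA.
rewrite /out PoszSum; apply: ler_sum => y yA.
by rewrite -[leLHS]mulr1 ler_wpM2l // -[1]add0r lezD1 subr_gt0 fA.
Qed.

(** The levels are settled from the last one down: [f] agrees with its value at the
portal below, so that chips on these levels cannot move and must all be there from
the start. At the next level, the chips that remain are too few to cross a cut
separating a vertex from its portal. *)
Lemma effective_deg_ge E : effective E -> (forall x, reaches E x) ->
  #|G|%:Z <= deg E.
Proof.
move=> eE rE; rewrite leNgt; apply/negP => small.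
have settle d : forall f, effective (E - lap f) ->
    forall x, (m < lev x + d)%N -> f x = f (p (lev x).-1).
  elim: d => [|d IH] f ef x; first by rewrite addn0 ltnNge (layer_le layered).
  rewrite addnS ltnS leq_eqVlt => /orP[/eqP lxd|]; last exact: IH.
  case lx: (lev x) => [|i].
    by congr (f _); apply: (layer_root layered) => //; apply: lev_p.
  have md j : (i.+1 < j)%N = (m < j + d)%N by rewrite lxd lx ltn_add2r.
  have settled g : effective (E - lap g) -> forall y, (i.+1 < lev y)%N -> lap g y = 0.
    move=> eg; apply: lap_settled => y; rewrite md; exact: IH.
  have E_pos y : (i.+1 < lev y)%N -> 1 <= E y.
    move=> ly; have [g eg] := rE y.
    have -> : (E - lap g) y = E y - lap g y by rewrite !ffunE.
    by rewrite settled // subr0.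
  have E_low : \sum_(y in below lev i.+1) E y < #|below lev i.+1|%:Z.
    move: small; rewrite /deg (bigID (mem (below lev i.+1))) /= -cardsT.
    rewrite -(cardsID (below lev i.+1) setT) setTI setTD PoszD => small.
    have : #|~: below lev i.+1|%:Z <= \sum_(y | y \notin below lev i.+1) E y.
      rewrite -sum1_card PoszSum (eq_bigl (fun y => y \notin below lev i.+1)).
        by apply: ler_sum => y; rewrite inE -ltnNge; apply: E_pos.
      by move=> y; rewrite inE.
    move=> high; rewrite -(ltrD2r #|~: below lev i.+1|%:Z).
    by apply: le_lt_trans small; rewrite lerD2l.
  have flow_low A : \sum_(y in A) lap f y < #|below lev i.+1|%:Z.
    apply: le_lt_trans E_low; rewrite (bigID (mem (below lev i.+1))) /=.
    rewrite [X in _ + X]big1 ?addr0 => [|y]; last first.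
      by move=> /andP[_]; rewrite inE -ltnNge; apply: settled.
    rewrite [leRHS](bigID (mem A)) /=.
    rewrite [X in X + _](eq_bigl (fun y => (y \in A) && (y \in below lev i.+1)));
      last by move=> y; rewrite andbC.
    apply: ler_wpDr; first by apply: sumr_ge0 => y _; apply: eE.
    apply: ler_sum => y _; have := ef y.
    have -> : (E - lap f) y = E y - lap f y by rewrite !ffunE.
    by rewrite subr_ge0.
  have no_cut A : (#|below lev i.+1| <= \sum_(y in A) out A y)%N ->
      ~ (forall y z, y \in A -> z \notin A -> f z < f y).
    move=> cutA /cut_flow_ge /le_lt_trans/(_ (flow_low A)).
    by rewrite ltz_nat ltnNge cutA.
  have step t : forall y z, y \in [set u | t <= f u] ->
      z \notin [set u | t <= f u] -> f z < f y.
    by move=> y z; rewrite !inE -ltNge => ty /lt_le_trans->.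
  (* A level set of [f] at the larger of the two values separates [x] from [p i]. *)
  rewrite /=; case: (ltgtP (f x) (f (p i))) => // fxp; exfalso.
    apply: no_cut (step (f (p i))); rewrite cut_sumC.
    by apply: (cut_sum_ge lx); rewrite !inE ?negbK ?lexx -?ltNge.
  apply: no_cut (step (f x)).
  by apply: (cut_sum_ge lx); rewrite !inE ?lexx -?ltNge.
suff : #|G|%:Z <= deg E by rewrite leNgt small.
rewrite -cardsT -deg_ind; apply: ler_sum => x _; rewrite ffunE inE.
have [f ef] := rE x; have -> : (E - lap f) x = E x - lap f x by rewrite !ffunE.
rewrite (@lap_settled f 0) ?subr0 // => y _; apply: (settle m.+1) => //.
by rewrite addnS ltnS leq_addl.
Qed.

Lemma layering_bound : pos_rank_deg_ge G #|G|%:Z.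
Proof.
move=> D rD; have [f ef _] := rD (p 0).
have -> : deg D = deg (D - lap f) by rewrite degD degN deg_lap oppr0 addr0.
apply: effective_deg_ge => // x; apply: (@reaches_lap _ _ (- f)).
by rewrite raddfN opprK subrK.
Qed.
End LayeringGonality.

(** * Layered graphs are the quasi-banana graphs *)

Section QuasiBananaLayering.

Lemma isomorphic_layering (G H : multigraph) m lev p :
  isomorphic G H -> @layering H m lev p ->
  exists m lev p, @layering G m lev p.
Proof.
move=> [f [g fK gK] fmult] lay; exists m, (lev \o f), (g \o p).
have card_pre i : #|below (lev \o f) i| = #|below lev i|.
  rewrite -(@on_card_preimset _ _ f); last by exists g => x _; rewrite ?fK ?gK.
  by apply: eq_card => x; rewrite !inE.
split=> [x|i im|x y x0 y0|x y].
- exact: (layer_le lay).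
- by rewrite /= gK (layer_portal lay).
- by apply: (can_inj fK); apply: (layer_root lay).
- rewrite -fmult (layer_multE lay) /layer_mult /layer_step !card_pre /=.
  by rewrite (can_eq fK) !(can2_eq fK gK).
Qed.

Lemma QB_layering m (N : m.-tuple nat) : (forall i, 0 < tnth N i)%N ->
  exists lev p, @layering (QB N) m lev p.
Proof.
move=> posN.
have size_gt0 (a : 'I_m.+1) : (0 < qb_size N a)%N.
  rewrite /qb_size; case: a => [[|a] am] //=.
  by have := posN (Ordinal (am : (a < m)%N)); rewrite (tnth_nth 0%N).
pose portal (a : 'I_m.+1) : QB N := existT _ a (Ordinal (size_gt0 a)).
pose lev (x : QB N) : nat := tag x.
have card_lev i : (i <= m)%N -> #|below lev i| = (\sum_(1 <= k < i.+1) qb_size N k + 1)%N.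
  move=> im; transitivity (\sum_(0 <= k < i.+1) qb_size N k)%N.
    transitivity (\sum_(a < m.+1 | (a <= i)%N) \sum_(b < qb_size N a) 1)%N.
      by rewrite sig_big_dep -sum1_card; apply: eq_bigl => x; rewrite inE andbT.
    rewrite (big_nat_widen _ _ m.+1) // big_mkord.
    by apply: eq_bigr => a _; rewrite sum1_card card_ord.
  by rewrite big_ltn // addnC.
exists lev, (fun i => portal (inord i)); split.
- by move=> x; rewrite -ltnS ltn_ord.
- by move=> i im; rewrite /lev /= inordK.
- case=> a b [a' b']; rewrite /lev /= => a0 a0'.
  have aa' : a = a' by apply: val_inj; rewrite /= a0 a0'.
  case: _ / aa' in b' a0' *; congr existT; apply: val_inj.
  have s1 : qb_size N a = 1%N by rewrite a0.
  case: b b' => b bs [b' bs'] /=.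
  by move: bs bs'; rewrite s1 !ltnS !leqn0 => /eqP-> /eqP->.
have stepE x y : layer_step lev (fun i => portal (inord i)) x y = qb_step x y.
  rewrite /layer_step /qb_step /lev inord_val.
  have -> : (x == portal (tag x)) = (tagged x == 0 :> nat).
    by case: x => a b; rewrite /portal eq_Tagged.
  by rewrite -[(tag x : nat)]/(lev x) card_lev -1?ltnS ?ltn_ord // addn1 addn2.
by move=> x y; rewrite /layer_mult !stepE.
Qed.

(** Within each level the portal must be listed first, since u_{i,1} is the vertex with
edges to the next level; the order of the others is immaterial. *)
Lemma layering_quasi_banana (G : multigraph) m lev p :
  @layering G m lev p -> quasi_banana G.
Proof.
move=> lay; have lev_p i : (i <= m)%N -> lev (p i) = i by apply: (layer_portal lay).
pose cls i := p i :: enum (layer lev i :\ p i).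
have cls_size i : (i <= m)%N -> size (cls i) = #|layer lev i|.
  by move=> im; rewrite /= -cardE [RHS](cardsD1 (p i)) inE lev_p // eqxx.
have cls_uniq i : uniq (cls i) by rewrite /= enum_uniq mem_enum !inE eqxx.
have mem_cls i x : (i <= m)%N -> (x \in cls i) = (lev x == i).
  move=> im; rewrite in_cons mem_enum !inE.
  by case: (eqVneq x (p i)) => //= ->; rewrite lev_p ?eqxx.
pose N : m.-tuple nat := [tuple size (cls i.+1) | i < m].
have sizeN i : (i <= m)%N -> qb_size N i = size (cls i).
  case: i => [_|i im]; last first.
    exact: (nth_mktuple (fun j : 'I_m => size (cls j.+1)) 0%N (Ordinal im)).
  rewrite cls_size //; apply/esym/eqP/cards1P; exists (p 0); apply/setP => x.
  rewrite !inE; apply/eqP/eqP => [x0|->]; last exact: lev_p.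
  by apply: (layer_root lay) => //; apply: lev_p.
pose g (x : QB N) : G := nth (p 0) (cls (tag x)) (tagged x).
have tag_le (x : QB N) : (tag x <= m)%N by rewrite -ltnS.
have tag_lt (x : QB N) : (tagged x < size (cls (tag x)))%N.
  by rewrite -sizeN // ltn_ord.
have lev_g x : lev (g x) = tag x by apply/eqP; rewrite -mem_cls ?mem_nth.
have g_inj : injective g.
  move=> x y gxy; have txy : tag x = tag y by apply: val_inj; rewrite /= -!lev_g gxy.
  move: gxy (tag_lt x) (tag_lt y); rewrite /g.
  case: x y txy => a b [a' b'] /= aa'; case: _ / aa' in b' *.
  move=> gxy sb sb'; congr existT; apply: val_inj; apply/eqP.
  by rewrite -(@nth_uniq _ (p 0) (cls a) b b' sb sb' (cls_uniq a)); apply/eqP.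
have g_surj y : exists x, g x = y.
  have ym : (lev y < m.+1)%N by rewrite ltnS (layer_le lay).
  have yc : y \in cls (lev y) by rewrite mem_cls // (layer_le lay).
  have iy : (index y (cls (lev y)) < qb_size N (Ordinal ym))%N.
    by rewrite sizeN ?(layer_le lay) // index_mem.
  by exists (existT _ (Ordinal ym) (Ordinal iy)); rewrite /g /= nth_index.
have [h gh] := fin_all_exists g_surj.
have hg : cancel g h by move=> x; apply: g_inj; rewrite gh.
have card_below i : (i <= m)%N ->
    #|below lev i|.+1 = (\sum_(1 <= k < i.+1) qb_size N k + 2)%N.
  elim: i => [_|i IH im].
    rewrite big_geq //; have -> : below lev 0 = layer lev 0.
      by apply/setP => x; rewrite !inE leqn0.
    by rewrite -cls_size // -sizeN.
  rewrite card_belowS -addSn IH ?(ltnW im) // [in RHS]big_nat_recr //=.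
  rewrite -cls_size // -sizeN //.
  by rewrite addnAC.
have stepE x y : layer_step lev p (g x) (g y) = qb_step x y.
  rewrite /layer_step /qb_step !lev_g.
  have -> : (g x == p (tag x)) = (tagged x == 0 :> nat).
    by rewrite /g -[p (tag x)]/(nth (p 0) (cls (tag x)) 0) nth_uniq.
  by rewrite card_below.
exists m, N; split=> [i|].
  by rewrite tnth_mktuple.
exists h; first by exists g.
move=> v w; rewrite -[in RHS](gh v) -[in RHS](gh w) (layer_multE lay).
by rewrite /layer_mult !stepE !lev_g (inj_eq g_inj).
Qed.

Lemma quasi_bananaP (G : multigraph) :
  quasi_banana G <-> exists m lev p, @layering G m lev p.
Proof.
split=> [[m [N [posN iso]]]|[m [lev [p lay]]]]; last exact: layering_quasi_banana lay.
by have [lev [p lay]] := QB_layering posN; apply: isomorphic_layering iso lay.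
Qed.
End QuasiBananaLayering.

(** * The characterisation *)

Theorem theorem1 (G : multigraph) (hG : connected G) :
  quasi_banana G <->
  gonality_tight G /\
  exists v : G, realises_gonality 2 (point v + \sum_(w : G) point w).
Proof.
have [G_gt0 _] := hG.
rewrite quasi_bananaP tight_realisesP //; split=> [[m [lev [p lay]]]|[bound [v rank2]]].
  split; first exact: layering_bound lay.
  exists (p 0); apply/survives2_vertices => //; exact: layering_rank2 lay.
by apply: (@core_layering G v) => //; apply/survives2_vertices.
Qed.
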